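(* Let $H$ be a finite-dimensional Hopf quasigroup over a field $k$, and let $\mathcal{I}_l^H\subseteq H^*$ be the space of left integrals on $H$. Then $\dim_k \mathcal{I}_l^H = 1$; that is, a (non-zero) left integral on $H$ exists and is unique up to scale.
   Context: Let $k$ be a field. A Hopf quasigroup over $k$ is a $k$-vector space $H$ with a unital, not necessarily associative, bilinear product, together with (unital) algebra homomorphisms $\Delta:H\to H\otimes H$ and $\varepsilon:H\to k$ forming a coassociative counital coalgebra, and a linear map $S:H\to H$ (the antipode) such that, in Sweedler notation $\Delta h=h_{(1)}\otimes h_{(2)}$ (summation omitted), for all $h,g\in H$: $S(h_{(1)})(h_{(2)}g)=h_{(1)}(S(h_{(2)})g)=(gS(h_{(1)}))h_{(2)}=(gh_{(1)})S(h_{(2)})=\varepsilon(h)g$. A left integral on $H$ is a linear functional $\lambda\in H^*$ such that $h_{(1)}\lambda(h_{(2)})=\lambda(h)1$ for all $h\in H$. The space of left integrals on $H$ is denoted $\mathcal{I}_l^H$. *)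

(* Defs.v *)
From HB Require Import structures.
From mathcomp Require Import all_boot all_algebra.

Set Implicit Arguments.
Unset Strict Implicit.
Unset Printing Implicit Defensive.

Import GRing.Theory.
Local Open Scope ring_scope.

Section Tensor.
Variable k : fieldType.
Implicit Types U V : vectType k.

(* The tensor product of finite-dimensional spaces, in coordinates: the entry  *)
(* (i, j) of t is its coefficient on e_i (x) f_j, for e = vbasis {:U} and      *)
(* f = vbasis {:V}. The lemmas tlift_pure and tlift_unique establish its       *)
(* universal property, hence its independence of the choice of the bases.      *)
Definition tensor U V : vectType k := 'M[k]_(\dim {:U}, \dim {:V}).

Definition tpure U V (u : U) (v : V) : tensor U V :=
  \matrix_(i, j) (coord (vbasis {:U}) i u * coord (vbasis {:V}) j v).

(* For a bilinear B, the linear map with u (x) v |-> B u v.                    *)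
Definition tlift U V (W : lmodType k) (B : U -> V -> W) (t : tensor U V) : W :=
  \sum_(i < \dim {:U}) \sum_(j < \dim {:V})
     (t : 'M_(_, _)) i j *: B (vbasis {:U})`_i (vbasis {:V})`_j.

End Tensor.

Notation "u \ox v" := (tpure u v) (at level 40, left associativity) : ring_scope.

(* Sweedler notation: if t = \sum_r x_r \ox y_r and F is bilinear in (x, y),   *)
(* this is \sum_r F(x_r, y_r).                                                 *)
Notation "'\sw_' ( x , y <- t ) F" := (tlift (fun x y => F) t)
  (at level 41, x name, y name, F at level 41,
   format "'[' '\sw_' ( x ,  y  <-  t ) '/  '  F ']'") : ring_scope.

Section TensorTheory.
Variables (k : fieldType) (U V : vectType k).

Lemma tlift_is_linear (W : lmodType k) (B : U -> V -> W) : linear (tlift B).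
Proof.
move=> a t t'; rewrite /tlift scaler_sumr -big_split; apply: eq_bigr => i _.
rewrite scaler_sumr -big_split; apply: eq_bigr => j _ /=.
by rewrite !mxE scalerDl scalerA.
Qed.

HB.instance Definition _ (W : lmodType k) (B : U -> V -> W) :=
  GRing.isLinear.Build k (tensor U V) W _ (tlift B) (tlift_is_linear B).

Lemma tpure_is_bilinear :
  bilinear_for *:%R *:%R (@tpure k U V : U -> V -> tensor U V).
Proof.
by split=> [v | u] a x y; apply/matrixP=> i j; rewrite !mxE linearP /=;
   rewrite ?mulrDl ?mulrDr ?mulrA // [_ * a]mulrC.
Qed.

HB.instance Definition _ :=
  bilinear_isBilinear.Build k U V (tensor U V) *:%R *:%R (@tpure k U V)
    tpure_is_bilinear.

Lemma tlift_pure (W : lmodType k) (B : {bilinear U -> V -> W}) u v :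
  \sw_(x, y <- u \ox v) B x y = B u v.
Proof.
rewrite {2}(coord_vbasis (memvf u)) linear_sumlz; apply: eq_bigr => i _ /=.
rewrite linearZl_LR {2}(coord_vbasis (memvf v)) linear_sumr scaler_sumr.
by apply: eq_bigr => j _; rewrite /= mxE linearZr_LR scalerA.
Qed.

Lemma tensor_gen (t : tensor U V) : \sw_(x, y <- t) x \ox y = t.
Proof.
rewrite /tlift {2}[t]matrix_sum_delta; apply: eq_bigr => i _.
apply: eq_bigr => j _; congr (_ *: _); apply/matrixP=> a b.
have freeb (X : vectType k) : free (vbasis {:X}) by exact: basis_free (vbasisP _).
by rewrite !mxE !coord_free // -natrM mulnb eq_sym [j == b]eq_sym.
Qed.

Lemma tlift_unique (W : lmodType k) (B : U -> V -> W)
    (f : {linear tensor U V -> W}) :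
  (forall u v, f (u \ox v) = B u v) -> f =1 tlift B.
Proof.
move=> fB t; rewrite -{1}(tensor_gen t) /tlift linear_sum; apply: eq_bigr => i _.
by rewrite linear_sum; apply: eq_bigr => j _; rewrite linearZ fB.
Qed.

End TensorTheory.

(* (a \ox b) (c \ox d) = ac \ox bd                                             *)
Definition tensor_mul (k : fieldType) (H : vectType k) (mul : H -> H -> H)
    (t u : tensor H H) : tensor H H :=
  \sw_(a, b <- t) \sw_(c, d <- u) (mul a c \ox mul b d).

(* No associativity of the product is assumed.                                 *)
Record hopf_quasigroup (k : fieldType) (H : vectType k) := HopfQuasigroup {
  hq_mul : {bilinear H -> H -> H};
  hq_one : H;
  hq_comul : 'Hom(H, tensor H H);
  hq_counit : 'Hom(H, k^o);
  hq_antipode : 'End(H);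
  hq_mul1l : left_id hq_one hq_mul;
  hq_mul1r : right_id hq_one hq_mul;
  hq_comulM : forall h g,
    hq_comul (hq_mul h g) = tensor_mul hq_mul (hq_comul h) (hq_comul g);
  hq_comul1 : hq_comul hq_one = hq_one \ox hq_one;
  hq_counitM : forall h g, hq_counit (hq_mul h g) = hq_counit h * hq_counit g;
  hq_counit1 : hq_counit hq_one = 1;
  hq_coassoc : forall h,
    \sw_(a, b <- hq_comul h) \sw_(a1, a2 <- hq_comul a) (a1 \ox (a2 \ox b)) =
    \sw_(a, b <- hq_comul h) \sw_(b1, b2 <- hq_comul b) (a \ox (b1 \ox b2));
  hq_counitl : forall h, \sw_(h1, h2 <- hq_comul h) (hq_counit h1 *: h2) = h;
  hq_counitr : forall h, \sw_(h1, h2 <- hq_comul h) (hq_counit h2 *: h1) = h;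
  hq_antipode_ll : forall h g,
    \sw_(h1, h2 <- hq_comul h) hq_mul (hq_antipode h1) (hq_mul h2 g)
    = hq_counit h *: g;
  hq_antipode_lr : forall h g,
    \sw_(h1, h2 <- hq_comul h) hq_mul h1 (hq_mul (hq_antipode h2) g)
    = hq_counit h *: g;
  hq_antipode_rl : forall h g,
    \sw_(h1, h2 <- hq_comul h) hq_mul (hq_mul g (hq_antipode h1)) h2
    = hq_counit h *: g;
  hq_antipode_rr : forall h g,
    \sw_(h1, h2 <- hq_comul h) hq_mul (hq_mul g h1) (hq_antipode h2)
    = hq_counit h *: g
}.

Section Integrals.
Variables (k : fieldType) (H : vectType k) (Q : hopf_quasigroup H).
Implicit Type lam : 'Hom(H, k^o).

Definition left_integral lam : Prop :=
  forall h, \sw_(h1, h2 <- hq_comul Q h) (lam h2 *: h1) = lam h *: hq_one Q.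

Definition integral_defect lam (h : H) : H :=
  \sw_(h1, h2 <- hq_comul Q h) (lam h2 *: h1) - lam h *: hq_one Q.

Lemma integral_defect_is_linear lam : linear (integral_defect lam).
Proof.
move=> a x y; rewrite /integral_defect !linearP /= scalerDl scalerBr scalerA.
by rewrite opprD addrACA.
Qed.

HB.instance Definition _ lam :=
  GRing.isLinear.Build k H H _ (integral_defect lam)
    (integral_defect_is_linear lam).

Definition integral_map lam : 'End(H) := linfun (integral_defect lam).

Lemma integral_map_is_linear : linear integral_map.
Proof.
move=> a lam mu; apply/lfunP=> h; rewrite !lfunE /= !lfunE /= /integral_defect /=.
rewrite !lfunE /= !lfunE /= scalerDl scalerBr scalerA opprD addrACA; congr (_ + _).
rewrite /tlift scaler_sumr -big_split; apply: eq_bigr => i _ /=.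
rewrite scaler_sumr -big_split; apply: eq_bigr => j _ /=.
by rewrite !lfunE /= !lfunE /= scalerDl scalerDr !scalerA mulrCA mulrA.
Qed.

HB.instance Definition _ :=
  GRing.isLinear.Build k 'Hom(H, k^o) 'End(H) _ integral_map
    integral_map_is_linear.

Definition left_integrals : {vspace 'Hom(H, k^o)} := lker (linfun integral_map).

Lemma left_integralsP lam :
  reflect (left_integral lam) (lam \in left_integrals).
Proof.
rewrite memv_ker lfunE /=; apply: (iffP eqP) => [/lfunP lam0 h | lamI].
  by have := lam0 h; rewrite !lfunE /= => /eqP; rewrite subr_eq0 => /eqP.
by apply/lfunP=> h; rewrite !lfunE /= /integral_defect lamI subrr.
Qed.

End Integrals.

(* Main.v *)
Require Import Defs.
From mathcomp Require Import all_boot all_algebra.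
From HB Require Import structures.
Import GRing.Theory.
Set Implicit Arguments.
Unset Strict Implicit.
Unset Printing Implicit Defensive.
Local Open Scope ring_scope.

(** Write S for the antipode, eps for the counit, e_i for a basis of H with dual
basis e^i, and f * m for the convolution product y |-> f(y1) m(y2) on H^*, which
is associative because the coproduct is coassociative, whatever the product of H.
A left integral is a functional lam with y1 lam(y2) = lam(y) 1. The proof follows
Larson and Sweedler: H^* is a Hopf module whose coinvariants are the left
integrals. The coaction is m |-> m0 (x) m1 := sum_i (e^i * m) (x) e_i, and h acts
by (m . h)(g) = m(g S(h)). Non-associativity is harmless, because every
product of three elements that has to be simplified is one of those that the
axioms of the antipode collapse, such as (g S(h1)) h2 or S(h1) (h2 g).

Preliminaries. The antipode reverses the coproduct ([sw_comul_antipode]), so that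
the axioms applied to S(h) in place of h give the cancellations
(x S(S(h2))) S(h1) = eps(h) x = (x S(h2)) S(S(h1)) ([sw_skew_rl], [sw_skew_rr]).

Existence. Project H^* onto its coinvariants as for any Hopf module: send m to
m0 . S(m1), that is, to the functional g |-> sum_i (e^i * m)(g S(S(e_i))), called
[trace_integral m] below. It is an integral ([trace_integralP]) by the first
cancellation and the coassociativity of the coaction ([coact_coassoc]). These
integrals cannot all vanish since, by the second cancellation, they rebuild every
functional: m(g) = sum_i trace_integral(e^i * m)(g S(e_i))
([trace_integral_recover]).

Uniqueness. For an integral lam, one has
  h1 lam(g h2) = S(g1) lam(g2 h)   ([integral_transfer]).
If lam is nonzero and lam(g h) = 0 for all g, then h1 lam(g h2) = 0 for all g, and
putting x S(h2) for g, with h3 in the place of h2, yields lam(x) h = 0, so h = 0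
([integral_nondegenerate]). Hence h |-> lam(_ h) is injective from H to H^*, and
bijective by dimension ([integral_translates]). If lam(_ h) is again an integral,
then the transfer identity reads lam(g h2) h1 = lam(g h) 1, so that by
nondegeneracy the coproduct of h is 1 (x) h, and h is the scalar eps(h)
([integral_translate_scalar]): lam(_ h) is a multiple of lam. *)

(** * Linearity of Sweedler expressions *)

Section Lin.
Variable k : fieldType.
Implicit Types U V W : lmodType k.
(* The values of a functional lie in the regular module k^o; reading them as  *)
(* scalars in k keeps all scalings over one and the same ring structure.      *)
Local Notation "c *:: v" := ((c : k) *: v) (at level 40, left associativity).

(** A proposition about bare functions, because the bodies of Sweedler sums are
anonymous functions, for which no structure of linear map can be inferred; the
tactic [linearity] proves it by following their syntax. *)
Definition lin U V (f : U -> V) := forall a x y, f (a *: x + y) = a *: f x + f y.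

Definition bilin U V W (B : U -> V -> W) :=
  (forall v, lin (B^~ v)) /\ (forall u, lin (B u)).

Lemma lin_id U : lin (fun x : U => x).
Proof. by []. Qed.

Lemma lin_eval (U V : vectType k) (x : U) : lin (fun h : 'Hom(U, V) => h x).
Proof. by move=> a h h'; rewrite !lfunE /= !lfunE. Qed.

Lemma lin_hom U (V W : vectType k) (h : 'Hom(V, W)) (f : U -> V) :
  lin f -> lin (fun x => h (f x)).
Proof. by move=> lf a x y; rewrite lf linearP. Qed.

Lemma lin_bilinl U V W (T : lmodType k) (B : V -> W -> T) (f : U -> V) w :
  bilin B -> lin f -> lin (fun x => B (f x) w).
Proof. by move=> [Bl _] lf a x y; rewrite lf Bl. Qed.

Lemma lin_bilinr U V W (T : lmodType k) (B : V -> W -> T) (f : U -> W) v :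
  bilin B -> lin f -> lin (fun x => B v (f x)).
Proof. by move=> [_ Br] lf a x y; rewrite lf Br. Qed.

Lemma lin_scalel U V (f : U -> k^o) (v : V) : lin f -> lin (fun x => f x *:: v).
Proof. by move=> lf a x y; rewrite lf scalerDl scalerA. Qed.

Lemma lin_scaler U V (c : k) (f : U -> V) : lin f -> lin (fun x => c *:: f x).
Proof. by move=> lf a x y; rewrite lf scalerDr !scalerA mulrC. Qed.

Lemma lin_sum U V (I : finType) (F : I -> U -> V) :
  (forall i, lin (F i)) -> lin (fun x => \sum_i F i x).
Proof.
move=> lF a x y; rewrite scaler_sumr -big_split.
by apply: eq_bigr => i _; rewrite lF.
Qed.

Lemma lin_sw_tensor U (V V' : vectType k) W (B : V -> V' -> W)
    (t : U -> tensor V V') :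
  lin t -> lin (fun x => tlift B (t x)).
Proof. by move=> lt a x y; rewrite lt linearP. Qed.

Lemma lin_sw_body U (V V' : vectType k) W (B : U -> V -> V' -> W)
    (t : tensor V V') :
  (forall v w, lin (fun x => B x v w)) -> lin (fun x => tlift (B x) t).
Proof.
move=> lB; do 2![apply: lin_sum => ?]; apply: lin_scaler; exact: lB.
Qed.

Lemma lin_image_sum U V (f : U -> V) (I : finType) (F : I -> U) :
  lin f -> f (\sum_i F i) = \sum_i f (F i).
Proof.
move=> lf.
have f0 : f 0 = 0.
  by have /eqP := lf 1 0 0; rewrite !scale1r addr0 -subr_eq0 opprD addrA subrr
     sub0r oppr_eq0 => /eqP.
apply: (big_morph f _ f0) => x y.
by have := lf 1 x y; rewrite !scale1r.
Qed.

Lemma linZ U V (f : U -> V) a x : lin f -> f (a *:: x) = a *:: f x.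
Proof.
move=> lf; have := lf (a - 1) x x.
by rewrite !scalerBl !scale1r !subrK.
Qed.

Lemma linfun_linE (U V : vectType k) (f : U -> V) x :
  lin f -> linfun f x = f x.
Proof.
move=> lf; pose fl := HB.pack_for {linear U -> V} f
  (GRing.isLinear.Build k U V _ f lf).
exact: (lfunE fl x).
Qed.

End Lin.

Section Sweedler.
Variables (k : fieldType) (U V : vectType k).
Implicit Types (W : lmodType k) (t : tensor U V).
Local Notation "c *:: v" := ((c : k) *: v) (at level 40, left associativity).

Lemma eq_sw W (B C : U -> V -> W) t :
  (forall x y, B x y = C x y) -> \sw_(x, y <- t) B x y = \sw_(x, y <- t) C x y.
Proof. by move=> BC; do 2![apply: eq_bigr => ? _]; rewrite BC. Qed.

Lemma sw_lin W W' (f : W -> W') (B : U -> V -> W) t :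
  lin f -> f (\sw_(x, y <- t) B x y) = \sw_(x, y <- t) f (B x y).
Proof.
move=> lf; rewrite /tlift lin_image_sum //; apply: eq_bigr => i _.
by rewrite lin_image_sum //; apply: eq_bigr => j _; rewrite linZ.
Qed.

Lemma sw_scale W c (B : U -> V -> W) t :
  c *:: (\sw_(x, y <- t) B x y) = \sw_(x, y <- t) (c *:: B x y).
Proof. by apply: (sw_lin (f := fun w => c *:: w)); apply: lin_scaler. Qed.

Lemma sw_scalel W (B : U -> V -> k^o) (w : W) t :
  (\sw_(x, y <- t) B x y) *:: w = \sw_(x, y <- t) (B x y *:: w).
Proof. by apply: (@sw_lin _ _ (fun c : k^o => c *:: w)); apply: lin_scalel. Qed.

(** The coordinates of a tensor as a Sweedler sum of elementary functionals. *)
Lemma sw_coord t i j :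
  \sw_(x, y <- t) (coord (vbasis {:U}) i x * coord (vbasis {:V}) j y : k^o)
  = (t : 'M_(_, _)) i j.
Proof.
rewrite -[in RHS](tensor_gen t).
rewrite (sw_lin (f := fun t : tensor U V => (t : 'M_(_, _)) i j : k^o)).
  by apply: eq_sw => x y; rewrite mxE.
by move=> a u v; rewrite !mxE.
Qed.

Lemma sw_pure W (B : U -> V -> W) u v :
  bilin B -> \sw_(x, y <- u \ox v) B x y = B u v.
Proof.
move=> [Bl Br]; pose Bb := HB.pack_for {bilinear U -> V -> W} B
  (bilinear_isBilinear.Build k U V W *:%R *:%R B (conj Bl Br)).
exact: (tlift_pure Bb u v).
Qed.

Lemma sw_sum W (I : finType) (B : I -> U -> V -> W) t :
  \sw_(x, y <- t) (\sum_i B i x y) = \sum_i \sw_(x, y <- t) B i x y.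
Proof.
rewrite /tlift [RHS]exchange_big; apply: eq_bigr => i _ /=.
rewrite [RHS]exchange_big; apply: eq_bigr => j _ /=.
by rewrite scaler_sumr.
Qed.

End Sweedler.

Lemma sw_exchange (k : fieldType) (U V U' V' : vectType k) (W : lmodType k)
    (B : U -> V -> U' -> V' -> W) (t : tensor U V) (u : tensor U' V') :
  \sw_(x, y <- t) \sw_(a, b <- u) B x y a b =
  \sw_(a, b <- u) \sw_(x, y <- t) B x y a b.
Proof.
rewrite [LHS](sw_sum (fun i x y => \sum_j (u : 'M_(_, _)) i j *:
  B x y (vbasis {:U'})`_i (vbasis {:V'})`_j)).
apply: eq_bigr => i _; rewrite [LHS](sw_sum (fun j x y => (u : 'M_(_, _)) i j *:
  B x y (vbasis {:U'})`_i (vbasis {:V'})`_j)).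
apply: eq_bigr => j _.
rewrite -(@sw_lin _ _ _ _ _ ( *:%R _)) //.
by apply: lin_scaler.
Qed.

Create HintDb bilin.

(** Follows the path from the root of a Sweedler expression to the single
occurrence of its variable; at a binary operation both sides are tried, and only
the one that contains the variable succeeds. Bilinear operations are recognized by a
hypothesis or by the hints in [bilin]. *)
Ltac linearity := idtac;
  lazymatch goal with
  | |- bilin _ => first [ done | split=> ?; cbv beta; linearity ]
  | |- forall _, _ => move=> ?; linearity
  | |- lin (fun x => x) => exact: lin_id
  | |- lin (fun x => tlift _ _) =>
      solve [ apply: lin_sw_tensor; linearity | apply: lin_sw_body; linearity ]
  | |- lin (fun x => \sum_i _) => apply: lin_sum; linearity
  | |- lin (fun x => _ *: _) =>
      solve [ apply: lin_scalel; linearity | apply: lin_scaler; linearity ]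
  | |- _ => solve [ done | eassumption | exact: lin_eval | apply: lin_hom; linearity
              | (apply: lin_bilinl; first (solve [by eauto with bilin])); linearity
              | (apply: lin_bilinr; first (solve [by eauto with bilin])); linearity ]
  end.

(** * Sweedler calculus and the antipode of a Hopf quasigroup *)

Section HopfQuasigroup.
Variables (k : fieldType) (H : vectType k) (Q : hopf_quasigroup H).
Implicit Types (W : lmodType k) (a b g h x y : H).
Local Notation "c *:: v" := ((c : k) *: v) (at level 40, left associativity).

Local Notation "x ** y" := (hq_mul Q x y) (at level 40, left associativity).
Local Notation Delta := (hq_comul Q).
Local Notation eps := (hq_counit Q).
Local Notation anti := (hq_antipode Q).
Local Notation one := (hq_one Q).

Lemma bilin_mul : bilin (hq_mul Q).
Proof. by split=> [v|u] a x y /=; rewrite ?linearPl ?linearPr. Qed.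
Hint Resolve bilin_mul : bilin.

Lemma counitl h : \sw_(h1, h2 <- Delta h) (eps h1 *:: h2) = h.
Proof. exact: hq_counitl. Qed.

Lemma counitr h : \sw_(h1, h2 <- Delta h) (eps h2 *:: h1) = h.
Proof. exact: hq_counitr. Qed.

Lemma antipode_ll h g :
  \sw_(h1, h2 <- Delta h) anti h1 ** (h2 ** g) = eps h *:: g.
Proof. exact: hq_antipode_ll. Qed.

Lemma antipode_lr h g :
  \sw_(h1, h2 <- Delta h) h1 ** (anti h2 ** g) = eps h *:: g.
Proof. exact: hq_antipode_lr. Qed.

Lemma antipode_rl h g :
  \sw_(h1, h2 <- Delta h) (g ** anti h1) ** h2 = eps h *:: g.
Proof. exact: hq_antipode_rl. Qed.

Lemma antipode_rr h g :
  \sw_(h1, h2 <- Delta h) (g ** h1) ** anti h2 = eps h *:: g.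
Proof. exact: hq_antipode_rr. Qed.

Definition trilin W (F : H -> H -> H -> W) :=
  [/\ forall y z, lin (fun x => F x y z), forall x z, lin (fun y => F x y z)
    & forall x y, lin (F x y)].

Lemma sw_coassoc W (F : H -> H -> H -> W) h : trilin F ->
  \sw_(a, b <- Delta h) \sw_(a1, a2 <- Delta a) F a1 a2 b =
  \sw_(a, b <- Delta h) \sw_(b1, b2 <- Delta b) F a b1 b2.
Proof.
case=> F1 F2 F3.
pose f (t : tensor H (tensor H H)) := \sw_(x, u <- t) \sw_(y, z <- u) F x y z.
have lf : lin f by exact: lin_sw_tensor.
have fE x y z : f (x \ox (y \ox z)) = F x y z.
  rewrite /f sw_pure ?sw_pure //.
  by split=> *; [apply: lin_sw_body | apply: lin_sw_tensor].
have := congr1 f (hq_coassoc Q h); rewrite !(sw_lin _ _ lf).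
under eq_sw => x y do rewrite (sw_lin _ _ lf); under eq_sw => x y do
  under eq_sw => ? ? do rewrite fE.
move=> ->; apply: eq_sw => x y; rewrite (sw_lin _ _ lf).
by under eq_sw => ? ? do rewrite fE.
Qed.

Lemma sw_counitl W (f : H -> W) h : lin f ->
  \sw_(h1, h2 <- Delta h) (eps h1 *:: f h2) = f h.
Proof.
move=> lf; rewrite -{2}[h]counitl (sw_lin _ _ lf).
by apply: eq_sw => *; rewrite linZ.
Qed.

Lemma sw_counitr W (f : H -> W) h : lin f ->
  \sw_(h1, h2 <- Delta h) (eps h2 *:: f h1) = f h.
Proof.
move=> lf; rewrite -{2}[h]counitr (sw_lin _ _ lf).
by apply: eq_sw => *; rewrite linZ.
Qed.

Lemma sw_comulM W (B : H -> H -> W) g h : bilin B ->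
  \sw_(x, y <- Delta (g ** h)) B x y =
  \sw_(a, b <- Delta g) \sw_(c, d <- Delta h) B (a ** c) (b ** d).
Proof.
move=> bB; rewrite hq_comulM /tensor_mul (@sw_lin _ _ _ _ _ (tlift B)).
  apply: eq_sw => a b; rewrite (@sw_lin _ _ _ _ _ (tlift B)).
    by apply: eq_sw => c d; rewrite sw_pure.
  by apply: lin_sw_tensor; linearity.
by apply: lin_sw_tensor; linearity.
Qed.

Lemma counit_antipode h : eps (anti h) = eps h.
Proof.
have := congr1 eps (antipode_ll h one).
rewrite linearZ /= hq_counit1 [eps h *:: _]mulr1 => <-.
rewrite (sw_lin (f := eps)); last by linearity.
rewrite -[in LHS](sw_counitr (f := fun x => eps (anti x)) h); last by linearity.
by apply: eq_sw => a b; rewrite hq_mul1r hq_counitM [_ *:: _]mulrC.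
Qed.

(** In Sweedler notation, (x h1) S(h4) (x) (y h2) S(h3) = eps(h) x (x) y: after
reassociating, the inner pair (h2, h3) cancels first, and then (h1, h4). *)
Lemma sw_quad W (B : H -> H -> W) x y h : bilin B ->
  \sw_(r, s <- Delta h) \sw_(r1, r2 <- Delta r) \sw_(s1, s2 <- Delta s)
    B ((x ** r1) ** anti s2) ((y ** r2) ** anti s1) = eps h *:: B x y.
Proof.
move=> bB.
rewrite sw_coassoc; last by split; linearity.
transitivity (\sw_(a, b <- Delta h)
  \sw_(p, d <- Delta b) \sw_(q, c <- Delta p)
     B ((x ** a) ** anti d) ((y ** q) ** anti c)).
  apply: eq_sw => a b.
  rewrite (sw_coassoc (F := fun q c d =>
    B ((x ** a) ** anti d) ((y ** q) ** anti c))) //.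
  by split; linearity.
transitivity (\sw_(a, b <- Delta h) B ((x ** a) ** anti b) y).
  apply: eq_sw => a b.
  rewrite -[RHS](sw_counitl (f := fun d => B ((x ** a) ** anti d) y) b);
    last by linearity.
  apply: eq_sw => p d.
  rewrite -(sw_lin (f := B ((x ** a) ** anti d))); last by linearity.
  by rewrite antipode_rr (linZ _ _ (bB.2 _)).
rewrite -(sw_lin (f := B ^~ y)); last by linearity.
by rewrite antipode_rr (linZ _ _ (bB.1 _)).
Qed.

Lemma sw_antipode_mul h :
  \sw_(h1, h2 <- Delta h) anti h1 ** h2 = eps h *:: one.
Proof. by rewrite -antipode_ll; apply: eq_sw => *; rewrite hq_mul1r. Qed.

Lemma sw_mul_antipode h :
  \sw_(h1, h2 <- Delta h) h1 ** anti h2 = eps h *:: one.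
Proof. by rewrite -antipode_lr; apply: eq_sw => *; rewrite hq_mul1r. Qed.

(** The antipode reverses the coproduct, by uniqueness of convolution inverses
of the coproduct, in the form that survives without associativity. In the tensor
square of H, the element
  (Delta(S(h1)) Delta(h2)) (S(h4) (x) S(h3))
equals Delta(S(h)) by [sw_quad], with Delta(S(h1)) for x (x) y, and equals
S(h2) (x) S(h1), because Delta(S(h1)) Delta(h2) = Delta(S(h1) h2) is a scalar.
Testing on a bilinear map avoids computing with tensors. *)
Lemma sw_comul_antipode W (B : H -> H -> W) h : bilin B ->
  \sw_(x, y <- Delta (anti h)) B x y =
  \sw_(a, b <- Delta h) B (anti b) (anti a).
Proof.
move=> bB.
rewrite -(sw_counitr (f := fun p => \sw_(x, y <- Delta (anti p)) B x y) h);
  last by linearity.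
pose G u s := \sw_(s1, s2 <- Delta s) \sw_(x, y <- Delta u)
  B (x ** anti s2) (y ** anti s1).
transitivity (\sw_(p, q <- Delta h) \sw_(r, s <- Delta q) G (anti p ** r) s).
  apply: eq_sw => p q.
  rewrite sw_scale; under eq_sw => x y do rewrite -(sw_quad x y q bB).
  rewrite sw_exchange; apply: eq_sw => r s; rewrite /G.
  under [RHS]eq_sw => s1 s2 do [rewrite sw_comulM; last by linearity].
  rewrite [RHS]sw_exchange; apply: eq_sw => x y.
  exact: sw_exchange.
rewrite -(sw_coassoc (F := fun p r s => G (anti p ** r) s)); last first.
  by rewrite /G; split; linearity.
transitivity (\sw_(u, s <- Delta h) (eps u *:: G one s)).
  apply: eq_sw => u s.
  have lG : lin (G^~ s) by rewrite /G; linearity.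
  by rewrite -(sw_lin (f := G^~ s)) // sw_antipode_mul (linZ _ _ lG).
rewrite sw_counitl; last by rewrite /G; linearity.
apply: eq_sw => s1 s2; rewrite hq_comul1 sw_pure ?hq_mul1l //.
by linearity.
Qed.

(** The axiom (x S(k1)) k2 = eps(k) x for k = S(h), where k1 (x) k2 is
S(h2) (x) S(h1). *)
Lemma sw_skew_rl x h :
  \sw_(a, b <- Delta h) (x ** anti (anti b)) ** anti a = eps h *:: x.
Proof.
rewrite -counit_antipode -antipode_rl sw_comul_antipode //.
by linearity.
Qed.

Lemma sw_skew_rr x h :
  \sw_(a, b <- Delta h) (x ** anti b) ** anti (anti a) = eps h *:: x.
Proof.
rewrite -counit_antipode -antipode_rr sw_comul_antipode //.
by linearity.
Qed.

Lemma comul_mul_antipode2 W (B : H -> H -> W) g h : bilin B ->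
  \sw_(x, y <- Delta (g ** anti (anti h))) B x y =
  \sw_(a, b <- Delta g) \sw_(c, d <- Delta h)
    B (a ** anti (anti c)) (b ** anti (anti d)).
Proof.
move=> bB; rewrite sw_comulM //; apply: eq_sw => a b.
rewrite sw_comul_antipode; last by linearity.
by rewrite sw_comul_antipode //; linearity.
Qed.

(** * Existence of a nonzero integral *)

Local Notation e := (vbasis {:H}).
Implicit Types (m lam mu : 'Hom(H, k^o)).

Definition conv (f : H -> k^o) m : 'Hom(H, k^o) :=
  linfun (fun y => \sw_(y1, y2 <- Delta y) (f y1 *:: m y2)).

Lemma convE (f : H -> k^o) m y : lin f ->
  conv f m y = \sw_(y1, y2 <- Delta y) (f y1 *:: m y2).
Proof. by move=> lf; rewrite linfun_linE //; linearity. Qed.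

Lemma lin_coord i : lin (coord e i : H -> k^o).
Proof. by move=> a x y; rewrite linearP. Qed.
Hint Resolve lin_coord : core.

Lemma sum_coordE W (f : H -> W) x :
  lin f -> \sum_i (coord e i x *:: f e`_i) = f x.
Proof.
move=> lf; rewrite {2}(coord_vbasis (memvf x)) lin_image_sum //.
by apply: eq_bigr => i _; rewrite linZ.
Qed.

(** The elements m0 (x) m1 := sum_i (e^i * m) (x) e_i define a coaction of H on
its dual: this is m0 (x) Delta(m1) = m00 (x) m01 (x) m1, tested on B. Comparing the
components on e_j (x) e_l, it says that e^j * e^l is the sum of the e^i with
coefficients the (j, l) coordinates of Delta(e_i). *)
Lemma coact_coassoc W (B : 'Hom(H, k^o) -> H -> H -> W) m :
  (forall a b, lin (fun n => B n a b)) ->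
  \sum_i \sw_(a, b <- Delta e`_i) B (conv (coord e i) m) a b =
  \sum_i \sum_j B (conv (coord e j) (conv (coord e i) m)) e`_j e`_i.
Proof.
move=> lB; rewrite [RHS]exchange_big /tlift [LHS]exchange_big.
apply: eq_bigr => j _ /=.
rewrite [LHS]exchange_big; apply: eq_bigr => l _ /=.
transitivity (B (\sum_(i < \dim {:H})
  (Delta e`_i : 'M_(_, _)) j l *:: conv (coord e i) m) e`_j e`_l).
  rewrite (lin_image_sum _ (lB _ _)); apply: eq_bigr => i _.
  exact: esym (linZ _ _ (lB _ _)).
congr (B _ _ _); apply/lfunP => y.
(* Both sides are the (j, l) coordinate of y1 (x) y2, paired with m(y3).     *)
transitivity (\sw_(p, y3 <- Delta y)
  ((Delta p : 'M_(_, _)) j l *:: (m y3 : k^o)) : k^o).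
  rewrite sum_lfunE.
  transitivity (\sum_(i < \dim {:H}) \sw_(p, y3 <- Delta y)
     (coord e i p *:: ((Delta e`_i : 'M_(_, _)) j l *:: (m y3 : k^o))) : k^o).
    apply: eq_bigr => i _; rewrite lfunE /= convE // sw_scale.
    by apply: eq_sw => p q; rewrite !scalerA mulrC.
  rewrite -sw_sum; apply: eq_sw => p q.
  rewrite (sum_coordE (f := fun x => (Delta x : 'M_(_, _)) j l *:: (m q : k^o))) //.
  by apply: lin_scalel => a u v; rewrite linearP !mxE.
rewrite convE //.
transitivity (\sw_(y1, q <- Delta y) \sw_(y2, y3 <- Delta q)
   (coord e j y1 *:: (coord e l y2 *:: m y3 : k^o)) : k^o).
  rewrite -(sw_coassoc (F := fun y1 y2 y3 =>
    (coord e j y1 *:: (coord e l y2 *:: m y3 : k^o)) : k^o)).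
    apply: eq_sw => p y3.
    rewrite -[(Delta p : 'M_(_, _)) j l]sw_coord sw_scalel.
    by apply: eq_sw => y1 y2; rewrite scalerA.
  by split; linearity.
by apply: eq_sw => y1 q; rewrite convE // sw_scale.
Qed.

(** The defining property of the coaction: m0(y) m1 = m(y2) y1. *)
Lemma sum_conv W (f : H -> W) m y : lin f ->
  \sum_i (conv (coord e i) m y *:: f e`_i)
  = \sw_(a, b <- Delta y) (m b *:: f a).
Proof.
move=> lf; transitivity (\sum_(i < \dim {:H})
    \sw_(a, b <- Delta y) (coord e i a *:: (m b *:: f e`_i))).
  apply: eq_bigr => i _; rewrite convE //.
  by rewrite sw_scalel; apply: eq_sw => a b; rewrite scalerA.
rewrite -sw_sum; apply: eq_sw => a b.
by rewrite (sum_coordE (f := fun x => m b *:: f x)) //; linearity.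
Qed.

(** The projection m0 . S(m1) of m onto the coinvariants of the Hopf module H^*;
its value at g is the trace of x |-> y1 m(y2), where y = g S(S(x)). *)
Definition trace_integral m : 'Hom(H, k^o) :=
  linfun (fun g => \sum_i conv (coord e i) m (g ** anti (anti e`_i))).

Lemma trace_integralE m g :
  trace_integral m g = \sum_i conv (coord e i) m (g ** anti (anti e`_i)).
Proof. by rewrite linfun_linE //; linearity. Qed.

(** Replaces g1 by (g1 S(S(x2))) S(x1), using [sw_skew_rl], in order to complete
g (x) x to the coproduct of g S(S(x)). *)
Lemma sw_insert_antipode m g x :
  \sw_(g1, g2 <- Delta g) (m (g2 ** anti (anti x)) *:: g1) =
  \sw_(a, q <- Delta x) \sw_(z1, z2 <- Delta (g ** anti (anti q)))
    (m z2 *:: (z1 ** anti a)).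
Proof.
under [RHS]eq_sw => a q do [rewrite comul_mul_antipode2; last by linearity].
rewrite [RHS]sw_exchange; apply: eq_sw => g1 g2.
rewrite -(sw_coassoc (F := fun a b c =>
  m (g2 ** anti (anti c)) *:: ((g1 ** anti (anti b)) ** anti a))); last first.
  by split; linearity.
rewrite -(sw_counitl (f := fun c => m (g2 ** anti (anti c)) *:: g1) x);
  last by linearity.
apply: eq_sw => p c; rewrite -sw_scale sw_skew_rl.
by rewrite !scalerA mulrC.
Qed.

(** The coaction pairs the antipode with the middle factor: the left-hand side is
z1 S(z2) m(z3). *)
Lemma sw_cancel_antipode m z :
  \sum_j \sw_(z1, z2 <- Delta z)
    (conv (coord e j) m z2 *:: (z1 ** anti e`_j)) = m z *:: one.
Proof.
rewrite -sw_sum.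
under eq_sw => z1 z2 do
  [rewrite (sum_conv (f := fun a => z1 ** anti a)); last by linearity].
rewrite -(sw_coassoc (F := fun z1 a b => m b *:: (z1 ** anti a))); last first.
  by split; linearity.
rewrite -(sw_counitl (f := fun b => m b *:: one)); last by linearity.
apply: eq_sw => u b; rewrite -sw_scale sw_mul_antipode.
by rewrite !scalerA mulrC.
Qed.

Lemma trace_integralP m : left_integral Q (trace_integral m).
Proof.
move=> g.
transitivity (\sum_(i < \dim {:H}) \sw_(g1, g2 <- Delta g)
  (conv (coord e i) m (g2 ** anti (anti e`_i)) *:: g1)).
  by rewrite -sw_sum; apply: eq_sw => g1 g2; rewrite trace_integralE scaler_suml.
under eq_bigr => i _ do rewrite sw_insert_antipode.
rewrite (coact_coassoc (B := fun n a q =>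
  \sw_(z1, z2 <- Delta (g ** anti (anti q))) (n z2 *:: (z1 ** anti a))));
  last by linearity.
rewrite trace_integralE scaler_suml; apply: eq_bigr => i _.
exact: sw_cancel_antipode.
Qed.

(** The Hopf module isomorphism from coinvariants (x) H onto H^*, composed with
its inverse: m = (m0 . S(m1)) . m2. *)
Lemma trace_integral_recover m g :
  \sum_i trace_integral (conv (coord e i) m) (g ** anti e`_i) = m g.
Proof.
under eq_bigr => i _ do rewrite trace_integralE.
rewrite -(coact_coassoc (B := fun n a b =>
  n ((g ** anti b) ** anti (anti a)))); last by linearity.
transitivity (\sum_i (conv (coord e i) m g *:: eps e`_i)).
  apply: eq_bigr => i _.
  rewrite -(sw_lin (f := conv (coord e i) m)); last by linearity.
  by rewrite sw_skew_rr linearZ /= [RHS]mulrC.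
rewrite (sum_conv (f := eps)); last by linearity.
rewrite -[RHS](sw_counitl (f := m)); last by linearity.
by apply: eq_sw => a b; rewrite [LHS]mulrC.
Qed.

Lemma exists_left_integral : exists2 lam, lam != 0 & left_integral Q lam.
Proof.
(* Some functional does not vanish at 1: the counit.                         *)
have [/forallP tr0|] :=
  boolP [forall i, trace_integral (conv (coord e i) eps) == 0].
  have := hq_counit1 Q; rewrite -(trace_integral_recover eps one).
  rewrite big1 => [/eqP|i _]; first by rewrite eq_sym oner_eq0.
  by rewrite (eqP (tr0 i)) lfunE.
rewrite negb_forall => /existsP[i tr_i].
by exists (trace_integral (conv (coord e i) eps)) => //; exact: trace_integralP.
Qed.

(** * Uniqueness of the integral *)

(** Both sides are S(g1) (g2 h1) lam(g3 h2): on one hand S(g1) cancels g2, and on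
the other hand lam is an integral at g2 h. *)
Lemma integral_transfer lam g h : left_integral Q lam ->
  \sw_(h1, h2 <- Delta h) (lam (g ** h2) *:: h1) =
  \sw_(g1, g2 <- Delta g) (lam (g2 ** h) *:: anti g1).
Proof.
move=> lamI.
transitivity (\sw_(g1, q <- Delta g) \sw_(z1, z2 <- Delta (q ** h))
  (lam z2 *:: (anti g1 ** z1))).
  under [RHS]eq_sw => g1 q do [rewrite sw_comulM; last by linearity].
  rewrite -(sw_coassoc (F := fun g1 g2 g3 => \sw_(h1, h2 <- Delta h)
    (lam (g3 ** h2) *:: (anti g1 ** (g2 ** h1))))); last by split; linearity.
  rewrite -(sw_counitl (f := fun g3 => \sw_(h1, h2 <- Delta h)
    (lam (g3 ** h2) *:: h1))); last by linearity.
  apply: eq_sw => p g3; rewrite sw_exchange sw_scale; apply: eq_sw => h1 h2.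
  by rewrite -sw_scale antipode_ll !scalerA mulrC.
apply: eq_sw => g1 q; rewrite -[anti g1 in RHS](hq_mul1r Q).
have := congr1 (fun x => anti g1 ** x) (lamI (q ** h)).
rewrite (sw_lin (f := fun x => anti g1 ** x)); last by linearity.
rewrite linearZr_LR /= => <-; apply: eq_sw => z1 z2.
by rewrite linearZr_LR.
Qed.

(** Transfer gives h1 lam(g h2) = 0 for all g. Applying the coproduct to h1 frees
a factor h2 that can be put into g as x S(h2), and lam((x S(h2)) h3) h1 is
lam(x) h. *)
Lemma integral_nondegenerate lam h : left_integral Q lam -> lam != 0 ->
  (forall g, lam (g ** h) = 0) -> h = 0.
Proof.
move=> lamI /eqP lam0 lamh; apply/eqP/contraT => h0; case: lam0.
apply/lfunP => x; rewrite lfunE /=; apply/eqP; apply: contraT => lamx.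
suff : lam x *:: h = 0 by move/eqP; rewrite scaler_eq0 (negPf h0) (negPf lamx).
have lamh2 g : \sw_(h1, h2 <- Delta h) (lam (g ** h2) *:: h1) = 0.
  rewrite integral_transfer // /tlift big1 // => i _; rewrite big1 // => j _.
  by rewrite lamh scale0r scaler0.
transitivity (\sw_(a, q <- Delta h) \sw_(b, c <- Delta q)
    (lam ((x ** anti b) ** c) *:: a)).
  rewrite -[in LHS](sw_counitr (f := id) h); last by linearity.
  rewrite sw_scale; apply: eq_sw => a q.
  rewrite -sw_scalel -(sw_lin (f := lam)); last by linearity.
  have llam : lin lam by linearity.
  by rewrite antipode_rl (linZ _ _ llam) scalerA mulrC.
rewrite -(sw_coassoc (F := fun a b c => lam ((x ** anti b) ** c) *:: a));
  last by split; linearity.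
(* In coordinates, the coproduct of p = h1 contributes for each basis pair     *)
(* e_j (x) e_l a linear function f of p, while g = x S(e_l) is now constant.   *)
rewrite sw_sum big1 // => j _; rewrite sw_sum big1 // => l _.
pose f p := (Delta p : 'M_(_, _)) j l *:: e`_j.
have lf : lin f by apply: lin_scalel => a u v; rewrite linearP !mxE.
have := congr1 f (lamh2 (x ** anti e`_l)).
rewrite (sw_lin _ _ lf) [f 0]/f linear0 mxE scale0r => f0.
rewrite -[RHS]f0; apply: eq_sw => p c.
by rewrite (linZ _ _ lf) /f !scalerA mulrC.
Qed.

Lemma antipode1 : anti one = one.
Proof.
have := antipode_ll one one.
rewrite hq_comul1 sw_pure; last by linearity.
by rewrite !hq_mul1r hq_counit1 scale1r.
Qed.

Definition translate lam h : 'Hom(H, k^o) := linfun (fun g => lam (g ** h)).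

Lemma translateE lam h g : translate lam h g = lam (g ** h).
Proof. by rewrite linfun_linE //; linearity. Qed.

(** Since S(1) = 1, transfer reads h1 lam(g h2) = lam(g h) 1 for all g, and
nondegeneracy turns it into f(h1) h2 = f(1) h for every functional f. The counit
then gives f(h) = f(eps(h) 1), and coordinate functionals suffice. *)
Lemma integral_translate_scalar lam h : left_integral Q lam -> lam != 0 ->
    left_integral Q (translate lam h) ->
  h = eps h *:: one.
Proof.
move=> lamI lam0 muI.
have transfer g : \sw_(h1, h2 <- Delta h) (lam (g ** h2) *:: h1)
    = lam (g ** h) *:: one.
  rewrite integral_transfer // -antipode1.
  have := congr1 anti (muI g); rewrite linearZ /= translateE.
  rewrite (sw_lin (f := anti)) => [<-|]; last by linearity.
  by apply: eq_sw => g1 g2; rewrite linearZ /= translateE.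
have coordh i : coord e i h = coord e i (eps h *:: one).
  have lf := lin_coord i; set f : H -> k^o := coord e i in lf *.
  have /eqP : \sw_(h1, h2 <- Delta h) (f h1 *:: h2) - f one *:: h = 0.
    apply: (integral_nondegenerate lamI lam0) => g.
    rewrite linearBr /= linearB /= linearZr_LR linearZ /=.
    rewrite (sw_lin (f := fun y => lam (g ** y))); last by linearity.
    apply/eqP; rewrite subr_eq0; apply/eqP.
    have := congr1 f (transfer g); rewrite (sw_lin _ _ lf).
    rewrite (linZ _ _ lf) [RHS]mulrC => E; apply: etrans E.
    apply: eq_sw => h1 h2.
    by rewrite linearZr_LR linearZ /= (linZ _ _ lf) [LHS]mulrC.
  rewrite subr_eq0 => /eqP /(congr1 eps).
  rewrite (sw_lin (f := eps)); last by linearity.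
  rewrite [RHS]linearZ /= => E.
  rewrite (linZ _ _ lf) [RHS]mulrC; apply: etrans E.
  rewrite -(sw_counitr h lf); apply: eq_sw => h1 h2.
  by rewrite linearZ /= [LHS]mulrC.
rewrite {1}(coord_vbasis (memvf h)) [RHS](coord_vbasis (memvf _)).
by apply: eq_bigr => i _; rewrite coordh.
Qed.

(** An injective linear map between spaces of the same dimension is onto. *)
Lemma integral_translates lam mu : left_integral Q lam -> lam != 0 ->
  exists h, mu = translate lam h.
Proof.
move=> lamI lam0.
pose psi : 'Hom(H, 'Hom(H, k^o)) := linfun (translate lam).
have psiE h g : psi h g = lam (g ** h).
  rewrite linfun_linE ?translateE // => a u v; apply/lfunP => y.
  by rewrite !lfunE /= !lfunE /= !translateE linearPr linearP.
have kpsi : lker psi == 0%VS.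
  apply/lker0P => u v uv; apply/eqP; rewrite -subr_eq0; apply/eqP.
  apply: (integral_nondegenerate lamI lam0) => g.
  by rewrite linearBr linearB /= -!psiE uv subrr.
have : mu \in limg psi.
  suff -> : limg psi = fullv by exact: memvf.
  apply/eqP; rewrite eqEdim subvf /= limg_dim_eq; last by rewrite (eqP kpsi) capv0.
  by rewrite !dimvf /dim /= muln1.
case/memv_imgP => h _ ->; exists h; apply/lfunP => g.
by rewrite psiE translateE.
Qed.

End HopfQuasigroup.

Theorem theorem3p5 (k : fieldType) (H : vectType k) (Q : hopf_quasigroup H) :
  \dim (left_integrals Q) = 1%N.
Proof.
have [lam lam0 lamI] := exists_left_integral Q.
suff -> : left_integrals Q = <[lam]>%VS by rewrite dim_vline lam0.
apply: subv_anti; apply/andP; split; last first.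
  by rewrite -memvE; apply/left_integralsP.
apply/subvP => mu /left_integralsP.
have [h ->] := integral_translates mu lamI lam0.
move=> /(integral_translate_scalar lamI lam0) hE.
apply/vlineP; exists (hq_counit Q h); apply/lfunP => g.
by rewrite translateE lfunE /= {1}hE linearZr_LR linearZ /= hq_mul1r.
Qed.
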